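(* All FUL2 functions are constant.
   Context: Let $\mathbf{D}$ be the open unit disk in $\mathbf{C}$. A FUL2 function (Lévy function for free unitary multiplicative processes of the second kind, with initial distribution $\mu_0=\delta_1$) is an analytic function $u$ on $\mathbf{D}$ with $\Re(u(z))\ge 0$ for all $z\in\mathbf{D}$, having the following property. Let $(F_t)_{t\ge 0}$ be the semigroup of analytic maps of $\mathbf{D}$ into itself obtained by solving $$\frac{\partial F_t}{\partial t}(z)+F_t(z)\,u(F_t(z))=0,\qquad F_0(z)=z .$$ One has $F_t(0)=0$ and $F_t'(0)=e^{-tu(0)}\neq 0$, so $F_t$ has an analytic inverse $F_t^{-1}$, fixing $0$, defined in a neighbourhood of $0$. The required property is that, for every $t>0$, the function $u\circ F_t^{-1}$ has an analytic continuation from a neighbourhood of $0$ to $\mathbf{D}$, taking values with nonnegative real part. *)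

(* Defs.v *)
From Stdlib Require Import Reals.
From Coquelicot Require Import Coquelicot.

Open Scope R_scope.

Definition disk (z : C) : Prop := Cmod z < 1.

(* The module structure of C over itself is given explicitly because C also
   carries a canonical structure of normed module over R. *)
Definition analytic_at (f : C -> C) (z0 : C) : Prop :=
  exists a : nat -> C,
    locally z0
      (fun z => @is_pseries C_AbsRing C_NormedModule a (z - z0)%C (f z)).

Definition analytic_on_disk (f : C -> C) : Prop :=
  forall z : C, disk z -> analytic_at f z.

(* Derivative of a curve on [0, +oo) along the half-line: two-sided for t > 0
   and one-sided (from the right) at t = 0. *)
Definition is_derive_halfline (f : R -> C) (t : R) (l : C) : Prop :=
  @filterdiff R_AbsRing R_NormedModule C_R_NormedModule
    f (within (fun s : R => 0 <= s) (locally t))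
    (fun h : R => @scal R_AbsRing C_R_NormedModule h l).

(* Only the values F t z with t >= 0 and z in the disk are meaningful. *)
Record is_flow (u : C -> C) (F : R -> C -> C) : Prop := {
  flow_disk : forall t z, 0 <= t -> disk z -> disk (F t z);
  flow_analytic : forall t, 0 <= t -> analytic_on_disk (F t);
  flow_init : forall z, disk z -> F 0 z = z;
  flow_semigroup : forall s t z, 0 <= s -> 0 <= t -> disk z ->
    F (s + t) z = F s (F t z);
  flow_ode : forall t z, 0 <= t -> disk z ->
    exists dF : C,
      is_derive_halfline (fun s => F s z) t dF /\
      (dF + F t z * u (F t z) = 0)%C
}.

Definition is_local_inverse_at_0 (f g : C -> C) : Prop :=
  analytic_at g 0%C /\ g 0%C = 0%C /\
  locally (0%C : C) (fun w => f (g w) = w) /\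
  locally (0%C : C) (fun z => g (f z) = z).

(* The flow F of u exists and is unique on [0, +oo) x disk, and so is the
   germ at 0 of the inverse g of F t: binding them existentially therefore only
   names these objects. *)
Definition FUL2 (u : C -> C) : Prop :=
  analytic_on_disk u /\
  (forall z, disk z -> 0 <= Re (u z)) /\
  exists F : R -> C -> C,
    is_flow u F /\
    forall t, 0 < t ->
      exists g : C -> C,
        is_local_inverse_at_0 (F t) g /\
        exists v : C -> C,
          analytic_on_disk v /\
          (forall w, disk w -> 0 <= Re (v w)) /\
          locally (0%C : C) (fun w => v w = u (g w)).

(* Main.v *)
Require Import Defs.
From Stdlib Require Import Reals Psatz List Classical ClassicalEpsilon.
From Coquelicot Require Import Coquelicot.

(* Let [v_t] be the continuation of [u o F_t^-1].  Then [v_t 0 = u 0], and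
   [u = v_t o F_t] on the whole disk by the identity theorem.  Since
   [Re v_t >= 0], the Schwarz lemma in the half-plane gives
   [|u z - u 0| (1 - |F_t z|) <= 2 Re (u 0) |F_t z|] for every [t > 0].  If
   [Re (u 0) = 0] this is the claim; otherwise Harnack's inequality bounds
   [Re u] away from [0] along the trajectory of [z], so [F_t z] tends to [0] and
   one lets [t] tend to infinity.

   The maximum modulus principle behind the Schwarz lemma and the identity
   theorem is derived without integration, from second order Taylor expansions
   only; these are stable under products, quotients and compositions, so power
   series need not be multiplied or composed. *)

(** * Second order Taylor expansions *)

(* [C] with the uniform structure given by [Cmod], as opposed to the product
   structure [C_UniformSpace]. *)
Local Notation CU := (AbsRing_UniformSpace C_AbsRing).

Definition Ccont (f : C -> C) (z : C) : Prop :=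
  @continuous CU CU f z.

(** Here [locally] refers to the product structure of [C]. The bridge to discs for [Cmod] lets the
    analytic hypotheses and the estimates on moduli be used together. *)
Lemma locally_Cmod (z : C) (P : C -> Prop) :
  locally z P <-> exists d : R, 0 < d /\ forall w, Cmod (w - z)%C < d -> P w.
Proof.
  split.
  - intros H. apply (proj1 (locally_C z P)) in H. destruct H as [d Hd].
    exists d. split; [apply cond_pos | exact Hd].
  - intros (d & Hd & H). apply (proj2 (locally_C z P)).
    exists (mkposreal d Hd). exact H.
Qed.

Lemma Ccont_Cmod (f : C -> C) (z : C) :
  Ccont f z <-> forall e : R, 0 < e ->
    exists d : R, 0 < d /\ forall w, Cmod (w - z)%C < d -> Cmod (f w - f z)%C < e.
Proof.
  split.
  - intros H e He.
    destruct (proj1 (@filterlim_locally _ CU _ _ f (f z)) H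
                (mkposreal e He)) as [d Hd].
    exists d. split; [apply cond_pos | exact Hd].
  - intros H. refine (proj2 (@filterlim_locally _ CU _ _ f (f z)) _).
    intros e.
    destruct (H e (cond_pos e)) as (d & Hd & H').
    exists (mkposreal d Hd). exact H'.
Qed.

Lemma Ccont_const (c z : C) : Ccont (fun _ => c) z.
Proof. exact (@continuous_const CU CU c z). Qed.

Lemma Ccont_id (z : C) : Ccont (fun w => w) z.
Proof. exact (@continuous_id CU z). Qed.

Lemma Ccont_plus (f g : C -> C) (z : C) :
  Ccont f z -> Ccont g z -> Ccont (fun w => f w + g w)%C z.
Proof.
  intros Hf Hg.
  exact (@continuous_plus CU C_AbsRing
           (AbsRing_NormedModule C_AbsRing) f g z Hf Hg).
Qed.

Lemma Ccont_mult (f g : C -> C) (z : C) :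
  Ccont f z -> Ccont g z -> Ccont (fun w => f w * g w)%C z.
Proof.
  intros Hf Hg.
  exact (@continuous_mult CU C_AbsRing f g z Hf Hg).
Qed.

Lemma Ccont_minus (f g : C -> C) (z : C) :
  Ccont f z -> Ccont g z -> Ccont (fun w => f w - g w)%C z.
Proof.
  intros Hf Hg.
  exact (@continuous_minus CU C_AbsRing
           (AbsRing_NormedModule C_AbsRing) f g z Hf Hg).
Qed.

Lemma Ccont_comp (f g : C -> C) (z : C) :
  Ccont f z -> Ccont g (f z) -> Ccont (fun w => g (f w)) z.
Proof. intros Hf Hg. exact (@continuous_comp CU CU
  CU f g z Hf Hg). Qed.

Lemma Ccont_ext_loc (f g : C -> C) (z : C) :
  locally z (fun w => f w = g w) -> Ccont f z -> Ccont g z.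
Proof.
  intros H Hf. apply (proj1 (locally_C z _)) in H.
  refine (@continuous_ext_loc CU
            CU g f z _ Hf).
  exact H.
Qed.

Lemma Ccont_locally (f : C -> C) (z : C) (P : C -> Prop) :
  Ccont f z -> locally (f z) P -> locally z (fun w => P (f w)).
Proof.
  intros Hf H. apply locally_C, Hf. apply (proj1 (locally_C (f z) P)), H.
Qed.

Lemma Ccont_inv (z : C) : z <> 0%C -> Ccont Cinv z.
Proof.
  intros Hz. apply Ccont_Cmod. intros e He.
  pose proof (proj1 (Cmod_gt_0 z) Hz) as Hp.
  (* The first radius keeps [|w| >= |z| / 2]; the second then makes [|w - z| / (|w| |z|)] smaller
     than [e]. *)
  exists (Rmin (Cmod z / 2) (e * Cmod z ^ 2 / 2)). split.
  { apply Rmin_pos; [lra|]. pose proof (Rmult_lt_0_compat _ _ He (pow_lt _ 2 Hp)). lra. }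
  intros w Hw.
  pose proof (Rlt_le_trans _ _ _ Hw (Rmin_l _ _)) as H1.
  pose proof (Rlt_le_trans _ _ _ Hw (Rmin_r _ _)) as H2.
  assert (Hwz : Cmod z / 2 <= Cmod w).
  { pose proof (Cmod_triangle w (- (w - z))%C) as T. rewrite Cmod_opp in T.
    replace (w + - (w - z))%C with z in T by ring. lra. }
  assert (Hw0 : w <> 0%C) by (apply Cmod_gt_0; lra).
  replace (/ w - / z)%C with (- (w - z) / (w * z))%C by (field; split; assumption).
  rewrite Cmod_div by (apply Cmult_neq_0; assumption).
  rewrite Cmod_opp, Cmod_mult.
  apply (Rmult_lt_reg_r (Cmod w * Cmod z)); [nra|].
  replace (Cmod (w - z)%C / (Cmod w * Cmod z) * (Cmod w * Cmod z))
    with (Cmod (w - z)%C) by (field; lra).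
  apply Rlt_le_trans with (1 := H2).
  replace (e * Cmod z ^ 2 / 2) with (e * (Cmod z / 2 * Cmod z)) by field.
  apply Rmult_le_compat_l; [lra|]. apply Rmult_le_compat_r; lra.
Qed.

Ltac ccont :=
  repeat match goal with
  | |- Ccont (fun w => Cplus _ _) _ => apply Ccont_plus
  | |- Ccont (fun w => Cminus _ _) _ => apply Ccont_minus
  | |- Ccont (fun w => Cmult _ _) _ => apply Ccont_mult
  | |- Ccont (fun w => w) _ => apply Ccont_id
  | |- Ccont (fun w => ?c) _ => apply Ccont_const
  | |- _ => assumption
  end.

(** Order two is what the maximum principle needs, since its perturbation has size [s^2]. The
    remainder is an exact factor [phi], continuous at [z] only, so that algebraic operations on
    functions become ring identities on the witnesses. *)
Definition taylor2 (f : C -> C) (z : C) : Prop :=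
  exists (a : C) (phi : C -> C), Ccont phi z /\
    locally z (fun w => f w = f z + a * (w - z) + (w - z) * (w - z) * phi w)%C.

Lemma taylor2_Ccont (f : C -> C) (z : C) : taylor2 f z -> Ccont f z.
Proof.
  intros (a & phi & Hc & H).
  refine (Ccont_ext_loc _ f z _ _).
  - refine (filter_imp _ _ _ H). intros w Hw. symmetry. exact Hw.
  - ccont.
Qed.

Lemma taylor2_ext_loc (f g : C -> C) (z : C) :
  locally z (fun w => f w = g w) -> taylor2 f z -> taylor2 g z.
Proof.
  intros E (a & phi & Hc & H). exists a, phi. split; [exact Hc|].
  pose proof (locally_singleton _ _ E) as E0. simpl in E0.
  generalize (filter_and _ _ E H). apply filter_imp.
  intros w [E1 E2]. rewrite <- E1, <- E0. exact E2.
Qed.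

Lemma taylor2_const (c z : C) : taylor2 (fun _ => c) z.
Proof.
  exists 0%C, (fun _ => 0%C). split; [apply Ccont_const|].
  apply filter_forall. intros w. ring.
Qed.

Lemma taylor2_plus (f g : C -> C) (z : C) :
  taylor2 f z -> taylor2 g z -> taylor2 (fun w => f w + g w)%C z.
Proof.
  intros (a & phi & Hc & H) (b & psi & Hd & G).
  exists (a + b)%C, (fun w => phi w + psi w)%C.
  split; [now apply Ccont_plus|].
  generalize (filter_and _ _ H G). apply filter_imp.
  intros w [E1 E2]. rewrite E1, E2 at 1. ring.
Qed.

Lemma taylor2_mult (f g : C -> C) (z : C) :
  taylor2 f z -> taylor2 g z -> taylor2 (fun w => f w * g w)%C z.
Proof.
  intros (a & phi & Hc & H) (b & psi & Hd & G).
  exists (a * g z + f z * b)%C, (fun w => a * b + f z * psi w + phi w * g z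
    + (w - z) * (a * psi w + b * phi w + (w - z) * (phi w * psi w)))%C.
  split.
  - ccont.
  - generalize (filter_and _ _ H G). apply filter_imp.
    intros w [E1 E2]. rewrite E1, E2 at 1. ring.
Qed.

Lemma taylor2_comp (f g : C -> C) (z : C) :
  taylor2 f z -> taylor2 g (f z) -> taylor2 (fun w => g (f w)) z.
Proof.
  intros Tf (b & psi & Hd & G).
  pose proof (taylor2_Ccont _ _ Tf) as Cf.
  destruct Tf as (a & phi & Hc & H).
  (* Obtained by substituting [f w - f z = (w - z) (a + (w - z) phi w)] into the expansion of [g] at
     [f z]. *)
  exists (b * a)%C, (fun w => b * phi w
    + (a + (w - z) * phi w) * (a + (w - z) * phi w) * psi (f w))%C.
  split.
  - ccont; now apply Ccont_comp.
  - pose proof (Ccont_locally f z _ Cf G) as G'. simpl in G'.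
    generalize (filter_and _ _ H G'). apply filter_imp.
    intros w [E1 E2]. rewrite E2 at 1.
    replace (f w - f z)%C with ((w - z) * (a + (w - z) * phi w))%C by (rewrite E1; ring).
    ring.
Qed.

Lemma taylor2_inv (z : C) : z <> 0%C -> taylor2 Cinv z.
Proof.
  (* The exact identity [1/w = 1/z - (w - z)/z^2 + (w - z)^2/(z^2 w)], valid for every nonzero
     [w]. *)
  intros Hz. exists (- / (z * z))%C, (fun w => / (z * z) * / w)%C. split.
  - apply Ccont_mult; [apply Ccont_const | now apply Ccont_inv].
  - apply locally_Cmod. exists (Cmod z).
    split; [now apply Cmod_gt_0|].
    intros w Hw. assert (w <> 0%C).
    { intros ->. replace (0 - z)%C with (- z)%C in Hw by ring.
      rewrite Cmod_opp in Hw. lra. }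
    field. tauto.
Qed.

Lemma taylor2_pow (f : C -> C) (z : C) (n : nat) :
  taylor2 f z -> taylor2 (fun w => f w ^ n)%C z.
Proof.
  intros Hf. induction n as [|n IH]; simpl.
  - apply taylor2_const.
  - now apply taylor2_mult.
Qed.

(** * Analytic functions *)

Lemma filterlim_Cmod (s : nat -> C) (l : C) :
  filterlim s eventually (locally l) ->
  forall e, 0 < e -> exists N, forall n, (N <= n)%nat -> Cmod (s n - l)%C < e.
Proof.
  intros H e He. apply (H (fun w => Cmod (w - l)%C < e)).
  apply locally_Cmod. now exists e.
Qed.

Lemma Cmod_pow_n (x : C) (n : nat) : Cmod (pow_n (K := C_Ring) x n) = Cmod x ^ n.
Proof.
  induction n as [|n IH]; simpl.
  - apply Cmod_1.
  - rewrite <- IH. apply Cmod_mult.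
Qed.

(** Convergence at [h0] bounds the terms there by some [B]. Halving the radius adds a factor [2^-n],
    so the sum is dominated by a geometric series of total [2 B]. *)
Lemma is_pseries_C_bounded (a : nat -> C) (h0 l0 : C) :
  h0 <> 0%C -> @is_pseries C_AbsRing C_NormedModule a h0 l0 ->
  exists M, forall h l : C, Cmod h <= Cmod h0 / 2 ->
    @is_pseries C_AbsRing C_NormedModule a h l -> Cmod l <= M.
Proof.
  intros Hh0 H0.
  pose proof (proj1 (Cmod_gt_0 _) Hh0) as P0.
  assert (HB : exists B, forall n, Cmod (pow_n (K := C_Ring) h0 n * a n)%C <= B).
  { destruct (filterlim_bounded (K := C_AbsRing) (V := C_NormedModule) _ (ex_intro _ l0 H0))
      as [M HM].
    (* Each term after the first is the difference of two consecutive partial sums, both bounded by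
       [M]. *)
    exists (M + M). intros [|n].
    - specialize (HM 0%nat). rewrite sum_O in HM.
      pose proof (Rle_trans _ _ _ (norm_ge_0 _) HM).
      change (Cmod (pow_n (K := C_Ring) h0 0 * a 0%nat)%C <= M) in HM. lra.
    - pose proof (HM n) as H1. pose proof (HM (S n)) as H2. rewrite sum_Sn in H2.
      set (S := sum_n _ n) in *. change C in (type of S).
      change (Cmod S <= M) in H1.
      change (Cmod (S + pow_n (K := C_Ring) h0 (Datatypes.S n) * a (Datatypes.S n))%C <= M) in H2.
      set (x := (pow_n (K := C_Ring) h0 (Datatypes.S n) * a (Datatypes.S n))%C) in *.
      replace x with ((S + x) + (- S))%C by ring.
      pose proof (Cmod_triangle (S + x)%C (- S)%C) as T. rewrite Cmod_opp in T. lra. }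
  destruct HB as [B HB].
  assert (HB0 : 0 <= B) by (apply Rle_trans with (1 := Cmod_ge_0 _) (2 := HB 0%nat)).
  exists (2 * B). intros h l Hh Hl.
  assert (Hterm : forall n, Cmod (pow_n (K := C_Ring) h n * a n)%C <= B * (/ 2) ^ n).
  { intros n. specialize (HB n). rewrite Cmod_mult in *.
    rewrite Cmod_pow_n in *.
    apply Rle_trans with ((Cmod h0 / 2) ^ n * Cmod (a n)).
    - apply Rmult_le_compat_r; [apply Cmod_ge_0|]. apply pow_incr.
      split; [apply Cmod_ge_0 | exact Hh].
    - unfold Rdiv. rewrite Rpow_mult_distr.
      pose proof (pow_lt (/ 2) n ltac:(lra)).
      replace (Cmod h0 ^ n * (/ 2) ^ n * Cmod (a n))
        with ((Cmod h0 ^ n * Cmod (a n)) * (/ 2) ^ n) by ring.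
      apply Rmult_le_compat_r; lra. }
  assert (Hsum : forall n, Cmod (sum_n (G := C_NormedModule)
      (fun k => scal (K := C_Ring) (V := C_NormedModule) (pow_n (K := C_Ring) h k) (a k)) n)
      <= B * (2 - (/ 2) ^ n)).
  { induction n as [|n IH].
    - rewrite sum_O. specialize (Hterm 0%nat). simpl (_ ^ 0) in *.
      apply Rle_trans with (1 := Hterm). lra.
    - rewrite sum_Sn. apply Rle_trans with (1 := Cmod_triangle _ _).
      specialize (Hterm (S n)). apply Rle_trans with (1 := Rplus_le_compat _ _ _ _ IH Hterm).
      simpl. lra. }
  apply le_epsilon. intros e He.
  destruct (filterlim_Cmod _ _ Hl e He) as [N HN].
  specialize (HN N (Nat.le_refl _)). specialize (Hsum N).
  set (S := sum_n _ N) in *. change C in (type of S).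
  change (Cmod S <= B * (2 - (/ 2) ^ N)) in Hsum.
  change (Cmod (S - l)%C < e) in HN.
  pose proof (Cmod_triangle S (- (S - l))%C) as T. rewrite Cmod_opp in T.
  replace (S + - (S - l))%C with l in T by ring.
  pose proof (pow_lt (/ 2) N ltac:(lra)). nra.
Qed.

(** The difference quotient, with [d] filled in at its removable singularity; the right choice of
    [d] is the derivative of [f] at [z0]. *)
Definition slope (f : C -> C) (z0 d : C) : C -> C :=
  fun w => if Ceq_dec w z0 then d else ((f w - f z0) / (w - z0))%C.

(** Dropping the constant coefficient and shifting the power series of [f] gives a power series for
    the difference quotient, whose value at [z0] is [a 1]. *)
Lemma analytic_at_slope (f : C -> C) (z0 : C) :
  analytic_at f z0 -> exists d, analytic_at (slope f z0 d) z0.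
Proof.
  intros [a H]. exists (a 1%nat), (PS_decr_1 (K := C_AbsRing) (V := C_NormedModule) a).
  assert (Ef : f z0 = a 0%nat).
  { pose proof (locally_singleton _ _ H) as H0. simpl in H0.
    replace (z0 - z0)%C with (zero : C) in H0 by (symmetry; apply Cplus_opp_r).
    exact (filterlim_locally_unique _ _ _ H0
      (is_pseries_0 (K := C_AbsRing) (V := C_NormedModule) a)). }
  refine (filter_imp _ _ _ H). intros w Hw. unfold slope.
  destruct (Ceq_dec w z0) as [->|Hwz].
  - replace (z0 - z0)%C with (zero : C) by (symmetry; apply Cplus_opp_r).
    apply (is_pseries_0 (K := C_AbsRing) (V := C_NormedModule)).
  - assert (Hn : (w - z0)%C <> 0%C).
    { intros E. apply Hwz. replace w with ((w - z0) + z0)%C by ring. rewrite E. ring. }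
    pose proof (is_pseries_decr_1 (K := C_AbsRing) (V := C_NormedModule) a (w - z0)%C
      (/ (w - z0))%C (f w) (Cinv_l _ Hn) Hw) as P.
    replace ((f w - f z0) / (w - z0))%C with (/ (w - z0) * (f w + - a 0%nat))%C; [exact P|].
    rewrite Ef. unfold Cdiv, Cminus. apply Cmult_comm.
Qed.

Lemma slope_eq (f : C -> C) (z0 d w : C) : f w = (f z0 + (w - z0) * slope f z0 d w)%C.
Proof.
  unfold slope. destruct (Ceq_dec w z0) as [->|H]; [ring|].
  field. intros E. apply H. replace w with ((w - z0) + z0)%C by ring. rewrite E. ring.
Qed.

(** The series converges at a point at distance [d / 2] from [z0], which bounds its sum on the disc
    of radius [d / 4]. *)
Lemma analytic_at_bounded (f : C -> C) (z0 : C) :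
  analytic_at f z0 -> exists M, locally z0 (fun w => Cmod (f w) <= M).
Proof.
  intros [a H]. apply locally_Cmod in H. destruct H as (d & Hd & H).
  assert (Ed : Cmod (RtoC (d / 2)) = d / 2) by (rewrite Cmod_R; apply Rabs_pos_eq; lra).
  assert (Hh : RtoC (d / 2) <> 0%C) by (apply Cmod_gt_0; rewrite Ed; lra).
  assert (H1 : Cmod (z0 + RtoC (d / 2) - z0)%C < d).
  { replace (z0 + RtoC (d / 2) - z0)%C with (RtoC (d / 2)) by ring. rewrite Ed. lra. }
  pose proof (H _ H1) as H0.
  replace (z0 + RtoC (d / 2) - z0)%C with (RtoC (d / 2)) in H0 by ring.
  destruct (is_pseries_C_bounded _ _ _ Hh H0) as [M HM].
  exists M. apply locally_Cmod. exists (d / 4). split; [lra|].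
  intros w Hw. apply (HM (w - z0)%C); [rewrite Ed; lra | apply H; lra].
Qed.

(** The difference quotient is again analytic, hence locally bounded, so [f] satisfies a Lipschitz
    estimate at [z0]. *)
Lemma analytic_at_Ccont (f : C -> C) (z0 : C) : analytic_at f z0 -> Ccont f z0.
Proof.
  intros H. destruct (analytic_at_slope _ _ H) as [d Hs].
  destruct (analytic_at_bounded _ _ Hs) as [M HM].
  apply locally_Cmod in HM. destruct HM as (r & Hr & HM).
  apply Ccont_Cmod. intros e He.
  assert (Hz : Cmod (z0 - z0)%C < r).
  { replace (z0 - z0)%C with (RtoC 0) by ring. now rewrite Cmod_0. }
  pose proof (Rle_trans _ _ _ (Cmod_ge_0 _) (HM z0 Hz)) as HM0.
  exists (Rmin r (e / (M + 1))). split.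
  { apply Rmin_pos; [exact Hr|]. apply Rdiv_lt_0_compat; lra. }
  intros w Hw.
  pose proof (Rlt_le_trans _ _ _ Hw (Rmin_l _ _)) as H1.
  pose proof (Rlt_le_trans _ _ _ Hw (Rmin_r _ _)) as H2.
  rewrite (slope_eq f z0 d w).
  replace (f z0 + (w - z0) * slope f z0 d w - f z0)%C
    with ((w - z0) * slope f z0 d w)%C by ring.
  rewrite Cmod_mult.
  apply Rle_lt_trans with (Cmod (w - z0)%C * (M + 1)).
  - apply Rmult_le_compat_l; [apply Cmod_ge_0|]. specialize (HM w H1). lra.
  - apply Rlt_le_trans with (e / (M + 1) * (M + 1)).
    + apply Rmult_lt_compat_r; lra.
    + right. field. lra.
Qed.

(** Taking the difference quotient twice yields the remainder factor, continuous at [z] because it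
    is analytic there. *)
Lemma analytic_at_taylor2 (f : C -> C) (z : C) : analytic_at f z -> taylor2 f z.
Proof.
  intros H. destruct (analytic_at_slope _ _ H) as [a H1].
  destruct (analytic_at_slope _ _ H1) as [b H2].
  exists (slope f z a z), (slope (slope f z a) z b).
  split; [now apply analytic_at_Ccont|].
  apply filter_forall. intros w.
  rewrite (slope_eq f z a w) at 1. rewrite (slope_eq (slope f z a) z b w) at 1. ring.
Qed.

(** * The maximum principle *)

(** If no maximum existed, every point would have a neighbourhood on which [Phi] stays below its
    value at some other point of the disc. Finitely many neighbourhoods cover the disc, and the
    largest of the corresponding values would lie below itself. Upper semicontinuity suffices for
    this. *)
Lemma disc_attains_max (Phi : C -> R) (r : R) :
  0 <= r ->
  (forall z, Cmod z <= r -> forall e, 0 < e ->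
     exists d, 0 < d /\ forall w, Cmod (w - z)%C < d -> Phi w < Phi z + e) ->
  exists z1, Cmod z1 <= r /\ forall w, Cmod w <= r -> Phi w <= Phi z1.
Proof.
  intros Hr Hc. apply NNPP. intros Hno.
  assert (Hbig : forall z, Cmod z <= r -> exists y, Cmod y <= r /\ Phi z < Phi y).
  { intros z Hz. apply NNPP. intros N. apply Hno. exists z. split; [exact Hz|].
    intros w Hw. destruct (Rle_or_lt (Phi w) (Phi z)) as [H|H]; [exact H|].
    exfalso. apply N. now exists w. }
  assert (Hloc : forall z : C, exists p : posreal * C, Cmod (snd p) <= r /\
            forall w, Cmod w <= r -> Cmod (w - z)%C < 2 * fst p -> Phi w < Phi (snd p)).
  { intros z. destruct (Rle_or_lt (Cmod z) r) as [Hz|Hz].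
    - destruct (Hbig z Hz) as (y & Hy & Hzy).
      destruct (Hc z Hz (Phi y - Phi z)) as (d & Hd & Hw); [lra|].
      assert (Hd2 : 0 < d / 2) by lra.
      exists (mkposreal _ Hd2, y). simpl. split; [exact Hy|].
      intros w _ H. specialize (Hw w). lra.
    (* The covering is of the whole square, so points outside the disc need a radius too: here the
       neighbourhood misses the disc, and the point [0] is a dummy value. *)
    - assert (Hd2 : 0 < (Cmod z - r) / 2) by lra.
      exists (mkposreal _ Hd2, RtoC 0). simpl. split; [now rewrite Cmod_0|].
      intros w Hw H. exfalso.
      pose proof (Cmod_triangle (- (w - z))%C w) as T. rewrite Cmod_opp in T.
      replace (- (w - z) + w)%C with z in T by ring. lra. }
  set (c := fun z => proj1_sig (constructive_indefinite_description _ (Hloc z))).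
  assert (Hcz : forall z, Cmod (snd (c z)) <= r /\
            forall w, Cmod w <= r -> Cmod (w - z)%C < 2 * fst (c z) -> Phi w < Phi (snd (c z))).
  { intros z. exact (proj2_sig (constructive_indefinite_description _ (Hloc z))). }
  clearbody c.
  set (tt2 := fun t : Compactness.Tn 2 R => (fst t, fst (snd t)) : C).
  (* Compactness of the square [[-r, r]^2] in doubly negated form, which is enough as the goal is
     [False]. Its cells are squares; the factor 2 in [Hcz] absorbs the [sqrt 2] between the
     coordinates and [Cmod]. *)
  apply (compactness_list 2 (- r, (- r, tt)) (r, (r, tt)) (fun t => fst (c (tt2 t)))).
  intros [l Hl].
  assert (Hmax : exists y, Cmod y <= r /\
            forall t, In t l -> Phi (snd (c (tt2 t))) <= Phi y).
  { clear Hl. induction l as [|t l IH].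
    - exists 0%C. split; [now rewrite Cmod_0 | intros t []].
    - destruct IH as (y & Hy & IH).
      destruct (Rle_or_lt (Phi (snd (c (tt2 t)))) (Phi y)) as [H|H].
      + exists y. split; [exact Hy|]. intros t' [<-|H']; auto.
      + exists (snd (c (tt2 t))). split; [apply Hcz|]. intros t' [<-|H']; [lra|].
        specialize (IH t' H'). lra. }
  destruct Hmax as (y & Hy & Hmax).
  pose proof (Rmax_Cmod y) as HR.
  destruct (Hl (fst y, (snd y, tt))) as (t & Ht & _ & Hclose).
  { pose proof (Rle_trans _ _ _ (Rmax_l _ _) HR) as H1.
    pose proof (Rle_trans _ _ _ (Rmax_r _ _) HR) as H2.
    simpl. repeat split; revert H1 H2; unfold Rabs;
      destruct (Rcase_abs (fst y)), (Rcase_abs (snd y)); lra. }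
  specialize (Hmax t Ht).
  destruct (Hcz (tt2 t)) as [_ Hlt].
  assert (Phi y < Phi (snd (c (tt2 t)))); [|lra].
  apply Hlt; [exact Hy|].
  destruct t as (t1 & t2 & t3). simpl in Hclose. destruct Hclose as (C1 & C2 & _).
  unfold tt2. simpl. unfold tt2 in C1, C2. simpl in C1, C2.
  apply Rle_lt_trans with (1 := Cmod_2Rmax _).
  simpl. set (d := pos _) in *.
  change (fst y - t1) with (fst y + - t1) in C1.
  change (snd y - t2) with (snd y + - t2) in C2.
  pose proof (Rmax_lub_lt _ _ _ C1 C2) as Hm.
  assert (Hs : sqrt 2 <= 2).
  { apply Rle_trans with (sqrt (2 * 2)); [apply sqrt_le_1_alt; lra|].
    rewrite sqrt_square; lra. }
  pose proof (sqrt_lt_R0 2 ltac:(lra)).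
  pose proof (Rmax_l (Rabs (fst y + - t1)) (Rabs (snd y + - t2))).
  pose proof (Rabs_pos (fst y + - t1)). nra.
Qed.

Lemma Cmod_sqr (z : C) : Cmod z ^ 2 = fst z ^ 2 + snd z ^ 2.
Proof. apply Cmod2_alt. Qed.

(* Averaging over [z + s], [z - s], [z + i s], [z - i s] cancels the terms of
   order 1 and 2 of [f], while the penalty [e |w|^2] gains [e s^2]. *)
Lemma taylor2_no_local_max (f : C -> C) (z : C) (e d : R) :
  taylor2 f z -> 0 < e -> 0 < d ->
  exists w, Cmod (w - z)%C < d /\
    Cmod (f z) ^ 2 + e * Cmod z ^ 2 < Cmod (f w) ^ 2 + e * Cmod w ^ 2.
Proof.
  intros (a & phi & Hc & H) He Hd. apply NNPP. intros Hno.
  assert (Hmax : forall w, Cmod (w - z)%C < d ->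
    Cmod (f w) ^ 2 + e * Cmod w ^ 2 <= Cmod (f z) ^ 2 + e * Cmod z ^ 2).
  { intros w Hw. apply Rnot_lt_le. intros L. apply Hno. now exists w. }
  clear Hno.
  set (G := Cmod (f z) + Cmod a + Cmod (phi z)).
  assert (HG : 0 <= G).
  { unfold G. pose proof (Cmod_ge_0 (f z)). pose proof (Cmod_ge_0 a).
    pose proof (Cmod_ge_0 (phi z)). lra. }
  (* Chosen so that [2 G eta < e]: the error [2 G s^2 eta] made in replacing [phi (z + h)] by
     [phi z] then stays below the gain [e s^2]. *)
  set (eta := e / (2 * G + 1)).
  assert (Heta : 0 < eta) by (unfold eta; apply Rdiv_lt_0_compat; lra).
  apply locally_Cmod in H. destruct H as (d1 & Hd1 & H).
  destruct (proj1 (Ccont_Cmod _ _) Hc eta Heta) as (d2 & Hd2 & Hphi).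
  set (s := Rmin (Rmin 1 d) (Rmin d1 d2) / 2).
  assert (Hs : 0 < s /\ s <= 1 /\ s < d /\ s < d1 /\ s < d2).
  { assert (0 < Rmin (Rmin 1 d) (Rmin d1 d2)) by (repeat apply Rmin_pos; lra).
    pose proof (Rmin_l (Rmin 1 d) (Rmin d1 d2)). pose proof (Rmin_r (Rmin 1 d) (Rmin d1 d2)).
    pose proof (Rmin_l 1 d). pose proof (Rmin_r 1 d).
    pose proof (Rmin_l d1 d2). pose proof (Rmin_r d1 d2). unfold s. lra. }
  destruct Hs as (Hs & Hs1 & Hsd & Hsd1 & Hsd2). clearbody s.
  assert (key : forall h : C, Cmod h = s ->
    Cmod (f z + a * h + h * h * phi z)%C ^ 2 - 2 * G * s ^ 2 * eta + e * Cmod (z + h)%C ^ 2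
      <= Cmod (f z) ^ 2 + e * Cmod z ^ 2).
  { intros h Hh.
    assert (E : (z + h - z)%C = h) by ring.
    pose proof (Hmax (z + h)%C) as M. rewrite E, Hh in M. specialize (M Hsd).
    pose proof (H (z + h)%C) as K. rewrite E, Hh in K. specialize (K Hsd1).
    pose proof (Hphi (z + h)%C) as P. rewrite E, Hh in P. specialize (P Hsd2).
    set (g := (f z + a * h + h * h * phi z)%C).
    assert (Hg : Cmod g <= G).
    { unfold g. apply Rle_trans with (1 := Cmod_triangle _ _).
      pose proof (Cmod_triangle (f z) (a * h)%C) as T1.
      rewrite !Cmod_mult, Hh in *. unfold G.
      pose proof (Cmod_ge_0 a). pose proof (Cmod_ge_0 (phi z)).
      assert (s * s <= 1) by nra. nra. }
    assert (Hfg : Cmod g <= Cmod (f (z + h)%C) + s ^ 2 * eta).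
    { assert (E2 : g = (f (z + h) + (- (h * h * (phi (z + h) - phi z))))%C).
      { rewrite K. unfold g. ring. }
      rewrite E2. apply Rle_trans with (1 := Cmod_triangle _ _).
      rewrite Cmod_opp, !Cmod_mult, Hh. pose proof (Rmult_lt_0_compat _ _ Hs Hs). nra. }
    assert (Cmod g ^ 2 - 2 * G * s ^ 2 * eta <= Cmod (f (z + h)%C) ^ 2); [|lra].
    pose proof (Cmod_ge_0 g). pose proof (Cmod_ge_0 (f (z + h)%C)).
    assert (Hx : 0 <= s ^ 2 * eta).
    { apply Rmult_le_pos; [apply pow2_ge_0 | lra]. }
    replace (2 * G * s ^ 2 * eta) with (2 * G * (s ^ 2 * eta)) by ring.
    set (x := s ^ 2 * eta) in *. clearbody x.
    (* In the second case the difference of squares factors: the difference of the moduli is at most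
       [x], their sum at most [2 G]. *)
    destruct (Rle_or_lt (Cmod g) (Cmod (f (z + h)%C))) as [L|L]; nra. }
  assert (HGe : 2 * G * eta < e).
  { unfold eta. apply (Rmult_lt_reg_r (2 * G + 1)); [lra|].
    replace (2 * G * (e / (2 * G + 1)) * (2 * G + 1)) with (2 * G * e) by (field; lra). nra. }
  assert (Hs2 : 0 < s ^ 2) by (apply pow_lt; exact Hs).
  assert (U : forall x y, x ^ 2 + y ^ 2 = s ^ 2 -> Cmod (x, y) = s).
  { intros x y E. unfold Cmod. simpl fst. simpl snd. rewrite E. apply sqrt_pow2. lra. }
  assert (K1 := key (s, 0) (U s 0 ltac:(ring))).
  assert (K2 := key (- s, 0) (U (- s) 0 ltac:(ring))).
  assert (K3 := key (0, s) (U 0 s ltac:(ring))).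
  assert (K4 := key (0, - s) (U 0 (- s) ltac:(ring))).
  rewrite !Cmod_sqr in *.
  destruct (f z) as [f1 f2], a as [a1 a2], (phi z) as [p1 p2], z as [z1 z2].
  simpl fst in *. simpl snd in *.
  (* Over the four values of [h], the squares [|f z + a h + h^2 phi z|^2] sum to [4 |f z|^2] plus
     this quantity, all cross terms cancelling. *)
  assert (HA : 0 <= 4 * (a1 ^ 2 + a2 ^ 2) * s ^ 2 + 4 * (p1 ^ 2 + p2 ^ 2) * (s ^ 2) ^ 2) by nra.
  nra.
Qed.

Lemma disc_attains_max_penalized (f : C -> C) (r e : R) :
  0 <= r -> 0 <= e -> (forall z, Cmod z <= r -> Ccont f z) ->
  exists z1, Cmod z1 <= r /\ forall w, Cmod w <= r ->
    Cmod (f w) ^ 2 + e * Cmod w ^ 2 <= Cmod (f z1) ^ 2 + e * Cmod z1 ^ 2.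
Proof.
  intros Hr He Hc.
  apply (disc_attains_max (fun w => Cmod (f w) ^ 2 + e * Cmod w ^ 2) r Hr).
  intros z Hz x Hx.
  set (a := Cmod (f z)). set (b := Cmod z).
  assert (Ha : 0 <= a) by apply Cmod_ge_0.
  assert (Hb : 0 <= b) by apply Cmod_ge_0.
  (* For [eta <= 1], one has [(a + eta)^2 <= a^2 + eta (2 a + 1)], and likewise for [b]; the last
     [+ 1] makes the final inequality strict. *)
  set (K := (2 * a + 1) + e * (2 * b + 1) + 1).
  assert (HK : 0 < K) by (unfold K; nra).
  set (eta := Rmin 1 (x / K)).
  assert (Heta : 0 < eta) by (apply Rmin_pos; [lra | now apply Rdiv_lt_0_compat]).
  assert (H1 : eta <= 1) by apply Rmin_l.
  assert (HKx : eta * K <= x).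
  { apply Rle_trans with (x / K * K).
    - apply Rmult_le_compat_r; [lra | apply Rmin_r].
    - right. field. lra. }
  clearbody eta.
  destruct (proj1 (Ccont_Cmod _ _) (Hc z Hz) eta Heta) as (d & Hd & H).
  exists (Rmin d eta). split; [now apply Rmin_pos|].
  intros w Hw.
  pose proof (H w (Rlt_le_trans _ _ _ Hw (Rmin_l _ _))) as Hf.
  pose proof (Rlt_le_trans _ _ _ Hw (Rmin_r _ _)) as Hw2.
  assert (A : Cmod (f w) <= a + eta).
  { pose proof (Cmod_triangle (f w - f z) (f z))%C as T.
    replace (f w - f z + f z)%C with (f w) in T by ring. fold a in T. lra. }
  assert (B : Cmod w <= b + eta).
  { pose proof (Cmod_triangle (w - z) z)%C as T.
    replace (w - z + z)%C with w in T by ring. fold b in T. lra. }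
  pose proof (Cmod_ge_0 (f w)). pose proof (Cmod_ge_0 w).
  assert (A2 : Cmod (f w) ^ 2 <= a ^ 2 + eta * (2 * a + 1)) by nra.
  assert (B2 : Cmod w ^ 2 <= b ^ 2 + eta * (2 * b + 1)) by nra.
  assert (B3 : e * Cmod w ^ 2 <= e * (b ^ 2 + eta * (2 * b + 1))).
  { now apply Rmult_le_compat_l. }
  unfold K in HKx. nra.
Qed.

Lemma Rle_of_sqr_le (x y : R) : 0 <= y -> x ^ 2 <= y ^ 2 -> x <= y.
Proof. intros Hy H. apply Rnot_lt_le. intros L. nra. Qed.

(** The maximum of [|f|^2 + e |w|^2] over the closed disc cannot be interior, so it lies on the
    circle and gives [|f z|^2 <= M^2 + e r^2]; then [e] is taken arbitrarily small. *)
Lemma maximum_modulus (f : C -> C) (r M : R) :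
  0 <= r -> (forall z, Cmod z <= r -> taylor2 f z) ->
  (forall z, Cmod z = r -> Cmod (f z) <= M) ->
  forall z, Cmod z <= r -> Cmod (f z) <= M.
Proof.
  intros Hr Ht Hb z Hz.
  assert (HM : 0 <= M).
  { apply Rle_trans with (1 := Cmod_ge_0 (f (RtoC r))). apply Hb.
    rewrite Cmod_R. now apply Rabs_pos_eq. }
  apply Rle_of_sqr_le; [exact HM|].
  apply le_epsilon. intros x Hx.
  assert (He : 0 < x / (r ^ 2 + 1)).
  { apply Rdiv_lt_0_compat; [exact Hx|]. pose proof (pow2_ge_0 r). lra. }
  set (e := x / (r ^ 2 + 1)) in *.
  destruct (disc_attains_max_penalized f r e Hr (Rlt_le _ _ He)) as (z1 & Hz1 & Hmax).
  { intros w Hw. now apply taylor2_Ccont, Ht. }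
  destruct (Rlt_or_le (Cmod z1) r) as [Hlt|Hge].
  - exfalso.
    destruct (taylor2_no_local_max f z1 e (r - Cmod z1) (Ht z1 Hz1) He) as (w & Hw & L); [lra|].
    assert (Hwr : Cmod w <= r).
    { pose proof (Cmod_triangle (w - z1) z1)%C as T.
      replace (w - z1 + z1)%C with w in T by ring. lra. }
    specialize (Hmax w Hwr). lra.
  - assert (Ez : Cmod z1 = r) by lra.
    specialize (Hmax z Hz). rewrite Ez in Hmax. specialize (Hb z1 Ez).
    assert (e * (r ^ 2 + 1) = x) by (unfold e; field; pose proof (pow2_ge_0 r); lra).
    pose proof (Cmod_ge_0 (f z1)).
    assert (Cmod (f z1) ^ 2 <= M ^ 2) by (apply pow_incr; lra).
    assert (0 <= e * Cmod z ^ 2) by (apply Rmult_le_pos; [lra | apply pow2_ge_0]).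
    lra.
Qed.

(* [f / z^n] is still regular at [0] for every [n], so that the maximum
   principle on [|z| <= r] gives [|f z| <= (|z| / r)^n max |f|]. *)
Lemma taylor2_identity (f : C -> C) :
  (forall z, disk z -> taylor2 f z) -> locally (0%C : C) (fun z => f z = 0%C) ->
  forall z, disk z -> f z = 0%C.
Proof.
  intros Ht H0 z Hz. unfold disk in *.
  set (r := (1 + Cmod z) / 2).
  pose proof (Cmod_ge_0 z) as Hz0.
  assert (Hr : 0 < r /\ r < 1 /\ Cmod z < r) by (unfold r; lra).
  destruct Hr as (Hr0 & Hr1 & Hzr). clearbody r.
  destruct (disc_attains_max_penalized f r 0) as (z1 & Hz1 & Hmax); [lra | lra | |].
  { intros w Hw. apply taylor2_Ccont, Ht. lra. }
  set (M := Cmod (f z1)).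
  assert (HM : forall w, Cmod w <= r -> Cmod (f w) <= M).
  { intros w Hw. apply Rle_of_sqr_le; [apply Cmod_ge_0|].
    specialize (Hmax w Hw). fold M in Hmax. lra. }
  destruct (Ceq_dec z 0%C) as [->|Hzn]; [exact (locally_singleton _ _ H0)|].
  pose proof (proj1 (Cmod_gt_0 z) Hzn) as Hzp.
  assert (Hn : forall n, Cmod (f z) <= M * (Cmod z / r) ^ n).
  { intros n.
    assert (Q : Cmod (f z * (/ z) ^ n)%C <= M * (/ r) ^ n).
    { apply (maximum_modulus (fun w => f w * (/ w) ^ n)%C r); [lra | | | lra].
      - intros w Hw. destruct (Ceq_dec w 0%C) as [->|Hwn].
        (* Near [0] the factor [f] vanishes, so the product is locally zero whatever value [/ 0]
           takes. *)
        + apply (taylor2_ext_loc (fun _ => 0%C)); [|apply taylor2_const].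
          refine (filter_imp _ _ _ H0). intros y Ey. rewrite Ey. ring.
        + apply taylor2_mult; [apply Ht; lra|].
          apply taylor2_pow. now apply taylor2_inv.
      - intros w Hw. assert (Hwn : w <> 0%C) by (apply Cmod_gt_0; lra).
        rewrite Cmod_mult, Cmod_pow, Cmod_inv, Hw by exact Hwn.
        apply Rmult_le_compat_r; [apply pow_le; left; now apply Rinv_0_lt_compat|].
        apply HM. lra. }
    rewrite Cmod_mult, Cmod_pow, Cmod_inv in Q by exact Hzn.
    apply (Rmult_le_compat_r (Cmod z ^ n)) in Q; [|apply pow_le; lra].
    rewrite !Rmult_assoc, <- !Rpow_mult_distr in Q.
    rewrite Rinv_l, pow1, Rmult_1_r in Q by lra.
    replace (Cmod z / r) with (/ r * Cmod z) by (unfold Rdiv; ring). exact Q. }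
  apply Cmod_eq_0. apply Rle_antisym; [|apply Cmod_ge_0].
  apply le_epsilon. intros e He.
  assert (HM0 : 0 <= M) by apply Cmod_ge_0.
  destruct (pow_lt_1_zero (Cmod z / r)) with (y := e / (M + 1)) as [N HN].
  { rewrite Rabs_pos_eq.
    - apply (proj1 (Rdiv_lt_1 _ _ Hr0)); lra.
    - apply Rlt_le, Rdiv_lt_0_compat; lra. }
  { apply Rdiv_lt_0_compat; lra. }
  specialize (HN N (Nat.le_refl _)). specialize (Hn N).
  pose proof (Rle_abs ((Cmod z / r) ^ N)).
  apply Rle_trans with (1 := Hn).
  apply Rle_trans with (M * (e / (M + 1))); [apply Rmult_le_compat_l; lra|].
  apply (Rmult_le_reg_r (M + 1)); [lra|].
  replace (M * (e / (M + 1)) * (M + 1)) with (M * e) by (field; lra). nra.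
Qed.

(** * Functions with nonnegative real part *)

(** The excess of the squared denominator of the Cayley transform over its squared numerator is a
    product of real parts. This shows that the transform maps into the unit disc, and it also yields
    Harnack's inequality. *)
Lemma Cmod_sqr_plus_conj (v v0 : C) (e : R) :
  Cmod (v + (Cconj v0 + RtoC (2 * e)))%C ^ 2
    = Cmod (v - v0)%C ^ 2 + 4 * (Re v + e) * (Re v0 + e).
Proof.
  rewrite !Cmod_sqr. destruct v, v0. unfold Re. simpl. ring.
Qed.

(* The Schwarz lemma for the Cayley transform [(v - v 0) / (v + conj (v 0))],
   with [v] replaced by [v + e] to allow [Re (v 0) = 0]. *)
Lemma half_plane_schwarz (v : C -> C) (e : R) :
  analytic_on_disk v -> (forall w, disk w -> 0 <= Re (v w)) ->
  0 <= e -> 0 < Re (v 0%C) + e ->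
  forall w, disk w -> Cmod (v w - v 0)%C <= Cmod w * Cmod (v w + (Cconj (v 0) + RtoC (2 * e)))%C.
Proof.
  intros Ha Hre He H0 w Hw.
  assert (D0 : disk 0%C) by (unfold disk; rewrite Cmod_0; lra).
  destruct (analytic_at_slope _ _ (Ha 0%C D0)) as [d Hd].
  set (A := slope v 0%C d) in *. set (B := fun w => (v w + (Cconj (v 0) + RtoC (2 * e)))%C).
  assert (HA : forall w, (v w - v 0)%C = (w * A w)%C).
  { intros y. rewrite (slope_eq v 0%C d y). unfold A. ring. }
  assert (HB : forall w, disk w -> Cmod (v w - v 0)%C <= Cmod (B w) /\ 0 < Cmod (B w)).
  { intros y Hy. specialize (Hre y Hy). split.
    - apply Rle_of_sqr_le; [apply Cmod_ge_0|]. unfold B.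
      rewrite Cmod_sqr_plus_conj. nra.
    - apply Rlt_le_trans with (Re (B y)).
      + unfold B. destruct (v y), (v 0%C). unfold Re in *. simpl in *. lra.
      + apply Rle_trans with (1 := Rle_abs _). apply re_le_Cmod. }
  (* At [0] the quotient is analytic as a slope; elsewhere it agrees locally with an honest
     quotient. *)
  assert (TA : forall y, disk y -> taylor2 A y).
  { intros y Hy. destruct (Ceq_dec y 0%C) as [->|Hy0]; [now apply analytic_at_taylor2|].
    apply (taylor2_ext_loc (fun x => (v x + - v 0) * / x)%C).
    - apply locally_Cmod. exists (Cmod y). split; [now apply Cmod_gt_0|].
      intros x Hx. assert (x <> 0%C).
      { intros ->. replace (0 - y)%C with (- y)%C in Hx by ring. rewrite Cmod_opp in Hx. lra. }
      change (v x + - v 0)%C with (v x - v 0)%C. rewrite HA. now field.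
    - apply taylor2_mult; [apply taylor2_plus|].
      + now apply analytic_at_taylor2, Ha.
      + apply taylor2_const.
      + now apply taylor2_inv. }
  (* The maximum principle for [A / B] on [|y| <= r]: on the circle
     [r |A y| = |v y - v 0| <= |B y|], so the quotient is at most [1 / r]. *)
  assert (Q : forall r, Cmod w < r -> r < 1 -> r * Cmod (A w) <= Cmod (B w)).
  { intros r Hwr Hr1. pose proof (Cmod_ge_0 w) as Hw0.
    destruct (HB w Hw) as [_ HBw].
    assert (Q : Cmod (A w * / B w)%C <= / r).
    { apply (maximum_modulus (fun y => A y * / B y)%C r); [lra | | | lra].
      - intros y Hy. assert (Dy : disk y) by (unfold disk; lra).
        apply taylor2_mult; [now apply TA|].
        apply (taylor2_comp B Cinv).
        + apply taylor2_plus; [now apply analytic_at_taylor2, Ha | apply taylor2_const].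
        + apply taylor2_inv, Cmod_gt_0, HB, Dy.
      - intros y Hy. assert (Dy : disk y) by (unfold disk; lra).
        destruct (HB y Dy) as [H1 H2].
        rewrite HA, Cmod_mult, Hy in H1.
        rewrite Cmod_mult, Cmod_inv by (now apply Cmod_gt_0).
        apply (Rmult_le_reg_r (r * Cmod (B y))); [nra|].
        replace (Cmod (A y) * / Cmod (B y) * (r * Cmod (B y))) with (r * Cmod (A y))
          by (field; lra).
        replace (/ r * (r * Cmod (B y))) with (Cmod (B y)) by (field; lra). exact H1. }
    rewrite Cmod_mult, Cmod_inv in Q by (now apply Cmod_gt_0).
    apply (Rmult_le_compat_r (r * Cmod (B w))) in Q; [|nra].
    replace (Cmod (A w) * / Cmod (B w) * (r * Cmod (B w))) with (r * Cmod (A w)) in Q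
      by (field; lra).
    replace (/ r * (r * Cmod (B w))) with (Cmod (B w)) in Q by (field; lra). exact Q. }
  rewrite HA, Cmod_mult. apply Rmult_le_compat_l; [apply Cmod_ge_0|].
  change (Cmod (A w) <= Cmod (B w)).
  (* Letting [r] tend to 1, done by contradiction: [r] is taken strictly between
     [max (|B w| / |A w|) |w|] and 1. *)
  apply Rnot_lt_le. intros L.
  pose proof (Cmod_ge_0 (B w)) as HBw.
  unfold disk in Hw. pose proof (Cmod_ge_0 w).
  set (q := Cmod (B w) / Cmod (A w)).
  assert (Hq : q < 1) by (apply -> Rdiv_lt_1; lra).
  assert (HqA : q * Cmod (A w) = Cmod (B w)) by (unfold q; field; lra).
  set (r := (1 + Rmax q (Cmod w)) / 2).
  assert (Hm : Rmax q (Cmod w) < 1) by (now apply Rmax_lub_lt).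
  pose proof (Rmax_l q (Cmod w)). pose proof (Rmax_r q (Cmod w)).
  specialize (Q r ltac:(unfold r; lra) ltac:(unfold r; lra)).
  assert (q < r) by (unfold r; lra). nra.
Qed.

(** Since [v w + conj (v 0) = (v w - v 0) + 2 Re (v 0)], the triangle inequality bounds the right
    side of the Schwarz estimate, and the term in [|v w - v 0|] is moved to the left. *)
Lemma half_plane_growth (v : C -> C) :
  analytic_on_disk v -> (forall w, disk w -> 0 <= Re (v w)) ->
  forall w, disk w -> Cmod (v w - v 0)%C * (1 - Cmod w) <= 2 * Re (v 0%C) * Cmod w.
Proof.
  intros Ha Hre w Hw.
  assert (D0 : disk 0%C) by (unfold disk; rewrite Cmod_0; lra).
  pose proof (Hre _ D0) as H0. unfold disk in Hw. pose proof (Cmod_ge_0 w).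
  apply le_epsilon. intros e He.
  pose proof (half_plane_schwarz v (e / 2) Ha Hre ltac:(lra) ltac:(lra) w Hw) as S.
  assert (T : Cmod (v w + (Cconj (v 0) + RtoC (2 * (e / 2))))%C
              <= Cmod (v w - v 0)%C + (2 * Re (v 0%C) + e)).
  { replace (v w + (Cconj (v 0) + RtoC (2 * (e / 2))))%C
      with ((v w - v 0) + RtoC (2 * Re (v 0%C) + e))%C.
    - apply Rle_trans with (1 := Cmod_triangle _ _).
      rewrite Cmod_R, Rabs_pos_eq; lra.
    - destruct (v w), (v 0%C). apply injective_projections; simpl; field. }
  nra.
Qed.

(** With [e = 0], the Schwarz estimate and [Cmod_sqr_plus_conj] give
    [(1 - |w|^2) b^2 <= 4 Re (v w) Re (v 0)], where [b] is the modulus of the Cayley denominator,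
    and [b >= Re (v 0)]. *)
Lemma half_plane_harnack (v : C -> C) :
  analytic_on_disk v -> (forall w, disk w -> 0 <= Re (v w)) ->
  forall w, disk w -> (1 - Cmod w ^ 2) * Re (v 0%C) <= 4 * Re (v w).
Proof.
  intros Ha Hre w Hw.
  assert (D0 : disk 0%C) by (unfold disk; rewrite Cmod_0; lra).
  pose proof (Hre _ D0) as H0. pose proof (Hre _ Hw) as H1.
  unfold disk in Hw. pose proof (Cmod_ge_0 w).
  destruct H0 as [H0|H0]; [|rewrite <- H0; lra].
  pose proof (half_plane_schwarz v 0 Ha Hre ltac:(lra) ltac:(lra) w Hw) as S.
  pose proof (Cmod_sqr_plus_conj (v w) (v 0%C) 0) as E.
  set (b := Cmod (v w + (Cconj (v 0) + RtoC (2 * 0)))%C) in *.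
  assert (Hb : Re (v 0%C) <= b).
  { apply Rle_trans with (Re (v w + (Cconj (v 0) + RtoC (2 * 0)))%C).
    - destruct (v w), (v 0%C). unfold Re in *. simpl in *. lra.
    - apply Rle_trans with (1 := Rle_abs _). apply re_le_Cmod. }
  set (x := Cmod (v w - v 0)%C) in *.
  assert (Hx : x ^ 2 <= Cmod w ^ 2 * b ^ 2).
  { rewrite <- Rpow_mult_distr. apply pow_incr. split; [apply Cmod_ge_0 | exact S]. }
  assert (P : (1 - Cmod w ^ 2) * b ^ 2 <= 4 * Re (v w) * Re (v 0%C)) by nra.
  assert (Hb2 : Re (v 0%C) ^ 2 <= b ^ 2) by (apply pow_incr; lra).
  assert (0 <= 1 - Cmod w ^ 2) by nra.
  apply (Rmult_le_reg_r (Re (v 0%C))); [exact H0|]. nra.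
Qed.

(** * The flow *)

Lemma is_derive_halfline_Cmod (f : R -> C) (t : R) (l : C) :
  0 <= t -> is_derive_halfline f t l ->
  forall e, 0 < e -> exists d, 0 < d /\ forall s, 0 <= s -> Rabs (s - t) < d ->
    Cmod (f s - f t - RtoC (s - t) * l)%C <= e * Rabs (s - t).
Proof.
  intros Ht [_ H] e He.
  (* [filterdiff] quantifies over the limits of the filter, so [t] must be shown to be one. *)
  assert (L : is_filter_lim (within (fun s : R => 0 <= s) (locally t)) t).
  { intros P HP. apply filter_imp with (2 := HP). auto. }
  destruct (H t L (mkposreal e He)) as [d Hd].
  exists d. split; [apply cond_pos|]. intros s Hs Hst.
  specialize (Hd s Hst Hs). rewrite Cmod_norm.
  refine (Rle_trans _ _ _ (Req_le _ _ _) Hd).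
  apply f_equal. apply injective_projections; simpl;
    unfold scal, minus, plus, opp; simpl; unfold mult; simpl; ring.
Qed.

(** Real linearity and [|p x| <= |x|] folded into the one inequality that carries difference
    quotients through [p]; both coordinates are then treated at once. *)
Definition nonexpansive_linear (p : C -> R) : Prop := forall (x y l : C) (h : R),
  Rabs (p x - p y - h * p l) <= Cmod (x - y - RtoC h * l)%C.

Lemma is_derive_halfline_proj (p : C -> R) (f : R -> C) (t : R) (l : C) :
  nonexpansive_linear p ->
  0 < t -> is_derive_halfline f t l -> is_derive (fun s => p (f s)) t (p l).
Proof.
  intros Hp_err Ht H. apply is_derive_Reals. intros e He.
  destruct (is_derive_halfline_Cmod f t l (Rlt_le _ _ Ht) H (e / 2)) as (d & Hd & K); [lra|].
  (* The bound [|h| < t] keeps [t + h] on the half-line, so the one-sided notion gives a two-sided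
     derivative. *)
  assert (Hm : 0 < Rmin d t) by (now apply Rmin_pos).
  exists (mkposreal _ Hm). simpl. intros h Hh0 Hh.
  pose proof (Rlt_le_trans _ _ _ Hh (Rmin_l _ _)) as H1.
  pose proof (Rlt_le_trans _ _ _ Hh (Rmin_r _ _)) as H2.
  apply Rabs_def2 in H2.
  specialize (K (t + h)). replace (t + h - t) with h in K by ring.
  specialize (K ltac:(lra) H1).
  pose proof (Hp_err (f (t + h)) (f t) l h) as P.
  assert (Hp : 0 < Rabs h) by (now apply Rabs_pos_lt).
  replace ((p (f (t + h)) - p (f t)) / h - p l)
    with ((p (f (t + h)) - p (f t) - h * p l) / h) by (now field).
  unfold Rdiv at 1. rewrite Rabs_mult, Rabs_inv.
  apply (Rmult_lt_reg_r (Rabs h)); [exact Hp|].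
  rewrite Rmult_assoc, Rinv_l, Rmult_1_r by lra. nra.
Qed.

Lemma halfline_proj_continuity_pt (p : C -> R) (f : R -> C) (t : R) (l : C) :
  nonexpansive_linear p ->
  0 <= t -> is_derive_halfline f t l -> continuity_pt (fun s => p (f (Rmax 0 s))) t.
Proof.
  intros Hp_err Ht H.
  destruct (is_derive_halfline_Cmod f t l Ht H 1) as (d & Hd & K); [lra|].
  apply continuity_pt_filterlim, filterlim_locally. intros e.
  (* Differentiability with error constant 1 gives the Lipschitz bound [1 + |p l|] at [t]; the 2
     leaves room for strictness. *)
  set (m := Rmin d (e / (2 + Rabs (p l)))).
  pose proof (Rabs_pos (p l)) as Hpl.
  assert (Hm : 0 < m).
  { apply Rmin_pos; [exact Hd|]. apply Rdiv_lt_0_compat; [apply cond_pos | lra]. }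
  exists (mkposreal m Hm). intros s Hs. change (Rabs (s - t) < m) in Hs.
  change (Rabs (p (f (Rmax 0 s)) - p (f (Rmax 0 t))) < e).
  rewrite (Rmax_right 0 t Ht).
  assert (Hst : Rabs (Rmax 0 s - t) < m).
  { apply Rle_lt_trans with (2 := Hs). unfold Rmax.
    destruct (Rle_dec 0 s); [lra|]. unfold Rabs.
    destruct (Rcase_abs (0 - t)), (Rcase_abs (s - t)); lra. }
  pose proof (Rlt_le_trans _ _ _ Hst (Rmin_l _ _)) as H1.
  pose proof (Rlt_le_trans _ _ _ Hst (Rmin_r _ _)) as H2.
  specialize (K _ (Rmax_l 0 s) H1).
  pose proof (Hp_err (f (Rmax 0 s)) (f t) l (Rmax 0 s - t)) as P.
  set (h := Rmax 0 s - t) in *. set (y := p (f (Rmax 0 s))) in *.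
  assert (Rabs (y - p (f t)) <= Rabs h * (1 + Rabs (p l))).
  { replace (y - p (f t)) with ((y - p (f t) - h * p l) + h * p l) by ring.
    apply Rle_trans with (1 := Rabs_triang _ _). rewrite Rabs_mult. lra. }
  assert (Rabs h * (2 + Rabs (p l)) < e).
  { apply (Rmult_lt_compat_r (2 + Rabs (p l))) in H2; [|lra].
    replace (e / (2 + Rabs (p l)) * (2 + Rabs (p l))) with (pos e) in H2 by (field; lra).
    exact H2. }
  pose proof (Rabs_pos h). lra.
Qed.

Lemma fst_nonexpansive : nonexpansive_linear fst.
Proof.
  intros x y l h.
  refine (Rle_trans _ _ _ _ (Rle_trans _ _ _ (Rmax_l _ _) (Rmax_Cmod _))).
  right. f_equal. simpl. ring.
Qed.

Lemma snd_nonexpansive : nonexpansive_linear snd.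
Proof.
  intros x y l h.
  refine (Rle_trans _ _ _ _ (Rle_trans _ _ _ (Rmax_r _ _) (Rmax_Cmod _))).
  right. f_equal. simpl. ring.
Qed.

(* Precomposing with [Rmax 0] extends the curve continuously to negative times,
   as the mean value theorem needs two-sided continuity at [0]. *)
Lemma halfline_Cmod_sqr_MVT (f df : R -> C) (b : R) :
  0 < b -> (forall t, 0 <= t -> is_derive_halfline f t (df t)) ->
  exists c, 0 <= c <= b /\
    Cmod (f b) ^ 2 - Cmod (f 0) ^ 2 = 2 * Re (Cconj (f c) * df c)%C * b.
Proof.
  intros Hb H.
  set (phi := fun s => fst (f (Rmax 0 s)) ^ 2 + snd (f (Rmax 0 s)) ^ 2).
  destruct (MVT_gen phi 0 b (fun c => 2 * Re (Cconj (f c) * df c)%C)) as (c & Hc & E).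
  - intros x. rewrite Rmin_left, Rmax_right by lra. intros Hx.
    apply (is_derive_ext_loc (fun s => fst (f s) ^ 2 + snd (f s) ^ 2)).
    { exists (mkposreal x (proj1 Hx)). intros y Hy. change (Rabs (y - x) < x) in Hy.
      apply Rabs_def2 in Hy. unfold phi. rewrite Rmax_right; [reflexivity | lra]. }
    pose proof (is_derive_halfline_proj fst f x _ fst_nonexpansive (proj1 Hx)
      (H x ltac:(lra))) as D1.
    pose proof (is_derive_halfline_proj snd f x _ snd_nonexpansive (proj1 Hx)
      (H x ltac:(lra))) as D2.
    evar_last.
    + apply (is_derive_plus (fun s => fst (f s) ^ 2) (fun s => snd (f s) ^ 2));
        apply is_derive_pow; eassumption.
    + unfold plus, Re. simpl. ring.
  - intros x. rewrite Rmin_left, Rmax_right by lra. intros Hx.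
    pose proof (halfline_proj_continuity_pt fst f x _ fst_nonexpansive (proj1 Hx)
      (H x (proj1 Hx))) as C1.
    pose proof (halfline_proj_continuity_pt snd f x _ snd_nonexpansive (proj1 Hx)
      (H x (proj1 Hx))) as C2.
    apply (continuity_pt_ext (fun s => fst (f (Rmax 0 s)) * fst (f (Rmax 0 s))
      + snd (f (Rmax 0 s)) * snd (f (Rmax 0 s)))); [intros s; unfold phi; ring|].
    apply (continuity_pt_plus (fun s => fst (f (Rmax 0 s)) * fst (f (Rmax 0 s)))
      (fun s => snd (f (Rmax 0 s)) * snd (f (Rmax 0 s)))).
    + exact (continuity_pt_mult _ _ _ C1 C1).
    + exact (continuity_pt_mult _ _ _ C2 C2).
  - rewrite Rmin_left, Rmax_right in Hc by lra. exists c. split; [exact Hc|].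
    unfold phi in E. rewrite (Rmax_right 0 b), (Rmax_right 0 0), <- !Cmod_sqr in E by lra.
    rewrite E. ring.
Qed.

(** Along a trajectory the derivative of [|F|^2] is [2 Re (conj F F') = - 2 |F|^2 Re (u F)]; the
    mean value theorem supplies the time [c]. *)
Lemma flow_Cmod_sqr (u : C -> C) (F : R -> C -> C) (t : R) (z : C) :
  is_flow u F -> 0 < t -> disk z ->
  exists c, 0 <= c <= t /\
    Cmod (F t z) ^ 2 = Cmod z ^ 2 - 2 * t * (Cmod (F c z) ^ 2 * Re (u (F c z))).
Proof.
  intros HF Ht Hz.
  destruct (halfline_Cmod_sqr_MVT (fun s => F s z) (fun s => (- (F s z * u (F s z)))%C) t Ht)
    as (c & Hc & E).
  - intros s Hs. destruct (flow_ode _ _ HF s z Hs Hz) as (dF & D & E).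
    replace (- (F s z * u (F s z)))%C with dF; [exact D|].
    replace dF with ((dF + F s z * u (F s z)) - F s z * u (F s z))%C by ring.
    rewrite E. ring.
  - exists c. split; [exact Hc|].
    cbv beta in E. rewrite (flow_init _ _ HF z Hz) in E.
    replace (Re (Cconj (F c z) * - (F c z * u (F c z)))%C)
      with (- (Cmod (F c z) ^ 2 * Re (u (F c z)))) in E.
    + lra.
    + rewrite Cmod_sqr. destruct (u (F c z)), (F c z). unfold Re. simpl. ring.
Qed.

Lemma flow_contracting (u : C -> C) (F : R -> C -> C) (t : R) (z : C) :
  (forall z, disk z -> 0 <= Re (u z)) -> is_flow u F -> 0 <= t -> disk z -> Cmod (F t z) <= Cmod z.
Proof.
  intros Hre HF Ht Hz. destruct Ht as [Ht|<-]; [|rewrite (flow_init _ _ HF z Hz); lra].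
  destruct (flow_Cmod_sqr u F t z HF Ht Hz) as (c & Hc & E).
  apply Rle_of_sqr_le; [apply Cmod_ge_0|].
  pose proof (Hre _ (flow_disk _ _ HF c z (proj1 Hc) Hz)).
  assert (0 <= Cmod (F c z) ^ 2 * Re (u (F c z))) by (apply Rmult_le_pos; [apply pow2_ge_0 | lra]).
  assert (0 <= t * (Cmod (F c z) ^ 2 * Re (u (F c z)))) by (apply Rmult_le_pos; lra).
  lra.
Qed.

(** At the intermediate time [c], the semigroup law and contraction give
    [|F t z| <= |F c z| <= |z|], and Harnack's inequality for [u] bounds [Re (u (F c z))] below. The
    resulting decay in [1 / t] of [|F t z|^2] suffices and avoids integrating a differential
    inequality. *)
Lemma flow_decay (u : C -> C) (F : R -> C -> C) (t : R) (z : C) :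
  analytic_on_disk u -> (forall z, disk z -> 0 <= Re (u z)) -> is_flow u F ->
  0 < t -> disk z ->
  Cmod (F t z) ^ 2 * (1 + t * ((1 - Cmod z ^ 2) * Re (u 0%C) / 2)) <= Cmod z ^ 2.
Proof.
  intros Hu Hre HF Ht Hz.
  destruct (flow_Cmod_sqr u F t z HF Ht Hz) as (c & Hc & E).
  pose proof (flow_disk _ _ HF c z (proj1 Hc) Hz) as Dc.
  pose proof (flow_contracting u F c z Hre HF (proj1 Hc) Hz) as H1.
  assert (H2 : Cmod (F t z) <= Cmod (F c z)).
  { replace t with ((t - c) + c) by ring.
    rewrite (flow_semigroup _ _ HF) by (lra || exact Hz).
    apply (flow_contracting u F); [exact Hre | exact HF | lra | exact Dc]. }
  pose proof (half_plane_harnack u Hu Hre _ Dc) as Hh.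
  assert (D0 : disk 0%C) by (unfold disk; rewrite Cmod_0; lra).
  pose proof (Hre _ D0) as H0.
  pose proof (Cmod_ge_0 (F c z)). pose proof (Cmod_ge_0 (F t z)).
  assert (S1 : Cmod (F c z) ^ 2 <= Cmod z ^ 2) by (apply pow_incr; lra).
  assert (S2 : Cmod (F t z) ^ 2 <= Cmod (F c z) ^ 2) by (apply pow_incr; lra).
  unfold disk in Hz. pose proof (Cmod_ge_0 z).
  set (k := (1 - Cmod z ^ 2) * Re (u 0%C)) in *.
  assert (Hk0 : 0 <= k) by (unfold k; apply Rmult_le_pos; nra).
  assert (Hk : k <= 4 * Re (u (F c z))) by (unfold k; nra).
  assert (P : Cmod (F t z) ^ 2 * k <= Cmod (F c z) ^ 2 * (4 * Re (u (F c z)))).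
  { apply Rmult_le_compat; try lra. apply pow2_ge_0. }
  apply (Rmult_le_compat_l t) in P; [|lra]. lra.
Qed.

(** Near [0], [v (F t z) = u (g (F t z)) = u z]; the identity theorem extends this to the disk. *)
Lemma flow_semiconjugacy (u : C -> C) (F : R -> C -> C) (t : R) (g v : C -> C) :
  analytic_on_disk u -> (forall z, disk z -> 0 <= Re (u z)) -> is_flow u F ->
  0 < t -> is_local_inverse_at_0 (F t) g -> analytic_on_disk v ->
  locally (0%C : C) (fun w => v w = u (g w)) ->
  forall z, disk z -> u z = v (F t z).
Proof.
  intros Hu Hre HF Ht (_ & _ & _ & Hg) Hv Hvg z Hz.
  assert (D0 : disk 0%C) by (unfold disk; rewrite Cmod_0; lra).
  (* Contraction forces this; it lets continuity of [F t] pull the neighbourhood where [v = u o g]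
     back to one of [0]. *)
  assert (F0 : F t 0%C = 0%C).
  { apply Cmod_eq_0, Rle_antisym; [|apply Cmod_ge_0].
    rewrite <- Cmod_0 at 2. apply (flow_contracting u F); [exact Hre | exact HF | lra | exact D0]. }
  assert (TF : forall w, disk w -> taylor2 (F t) w).
  { intros w Hw. now apply analytic_at_taylor2, (flow_analytic _ _ HF t (Rlt_le _ _ Ht)). }
  assert (E : (u z + - (1) * v (F t z))%C = 0%C).
  { apply (taylor2_identity (fun w => u w + - (1) * v (F t w))%C); [| |exact Hz].
    - intros w Hw. apply taylor2_plus; [now apply analytic_at_taylor2, Hu|].
      apply taylor2_mult; [apply taylor2_const|].
      apply taylor2_comp; [now apply TF|].
      apply analytic_at_taylor2, Hv, (flow_disk _ _ HF); [lra | exact Hw].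
    - pose proof (Ccont_locally (F t) 0%C (fun w => v w = u (g w))
        (taylor2_Ccont _ _ (TF _ D0))) as L.
      rewrite F0 in L. specialize (L Hvg). simpl in L.
      generalize (filter_and _ _ Hg L). apply filter_imp.
      intros w [E1 E2]. rewrite E2, E1. ring. }
  replace (u z) with ((u z + - (1) * v (F t z)) + v (F t z))%C by ring.
  rewrite E. ring.
Qed.

Theorem theorem5p3 (u : C -> C) :
  FUL2 u -> exists c : C, forall z : C, disk z -> u z = c.
Proof.
  intros (Hu & Hre & F & HF & H). exists (u 0%C). intros z Hz.
  assert (D0 : disk 0%C) by (unfold disk; rewrite Cmod_0; lra).
  pose proof (Hre _ D0) as H0.
  set (x := Cmod (u z - u 0)%C). set (a := Re (u 0%C)) in *.
  set (b := 1 - Cmod z).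
  assert (Hb : 0 < b <= 1) by (unfold b; unfold disk in Hz; pose proof (Cmod_ge_0 z); lra).
  assert (Hx : 0 <= x) by apply Cmod_ge_0.
  (* The growth estimate for [v] at [F t z], with [v 0 = u 0] and [1 - |F t z| >= b] by
     contraction. *)
  assert (key : forall t, 0 < t -> x * b <= 2 * a * Cmod (F t z)).
  { intros t Ht. destruct (H t Ht) as (g & Hg & v & Hv & Hvre & Hvg).
    pose proof (flow_semiconjugacy u F t g v Hu Hre HF Ht Hg Hv Hvg) as E.
    pose proof (half_plane_growth v Hv Hvre _ (flow_disk _ _ HF t z (Rlt_le _ _ Ht) Hz)) as G.
    assert (Ev : v 0%C = u 0%C).
    { rewrite (locally_singleton _ _ Hvg). now rewrite (proj1 (proj2 Hg)). }
    rewrite <- (E z Hz), Ev in G. fold x a in G.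
    pose proof (flow_contracting u F t z Hre HF (Rlt_le _ _ Ht) Hz).
    apply Rle_trans with (2 := G). apply Rmult_le_compat_l; [exact Hx | unfold b; lra]. }
  assert (Hx0 : x = 0).
  { destruct H0 as [H0|H0]; [|specialize (key 1 Rlt_0_1); rewrite <- H0 in key; nra].
    apply NNPP. intros Hne. assert (Hxp : 0 < x) by lra.
    set (k := (1 - Cmod z ^ 2) * a / 2).
    assert (Hk : 0 < k).
    { assert (0 < 1 - Cmod z ^ 2).
      { unfold disk in Hz. pose proof (Cmod_ge_0 z). nra. }
      unfold k. apply Rdiv_lt_0_compat; [now apply Rmult_lt_0_compat | lra]. }
    set (q := (x * b) ^ 2).
    assert (Hq : 0 < q) by (apply pow_lt; apply Rmult_lt_0_compat; lra).
    (* An explicit time replaces the limit. As [q t k = 4 a^2], the bounds [key] and [flow_decay]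
       give [q + 4 a^2 = q (1 + t k) <= 4 a^2 |z|^2 <= 4 a^2], contradicting [q > 0]. *)
    set (t := 4 * a ^ 2 / (q * k)).
    assert (Hqk : 0 < q * k) by (now apply Rmult_lt_0_compat).
    assert (Ht : 0 < t).
    { apply Rdiv_lt_0_compat; [|exact Hqk]. pose proof (pow_lt a 2 H0). lra. }
    assert (Etk : q * (t * k) = 4 * a ^ 2) by (unfold t; field; split; lra).
    pose proof (flow_decay u F t z Hu Hre HF Ht Hz) as Dc. fold a k in Dc.
    assert (Q : q <= (2 * a * Cmod (F t z)) ^ 2).
    { apply pow_incr. split; [apply Rmult_le_pos; lra | now apply key]. }
    assert (Hz1 : Cmod z ^ 2 <= 1).
    { unfold disk in Hz. pose proof (Cmod_ge_0 z). nra. }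
    assert (Htk : 0 < t * k) by (now apply Rmult_lt_0_compat).
    apply (Rmult_le_compat_r (1 + t * k)) in Q; [|lra].
    assert (4 * a ^ 2 * (Cmod (F t z) ^ 2 * (1 + t * k)) <= 4 * a ^ 2).
    { pose proof (pow2_ge_0 a). nra. }
    nra. }
  apply Cmod_eq_0 in Hx0.
  replace (u z) with ((u z - u 0) + u 0)%C by ring. rewrite Hx0. ring.
Qed.
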